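(* Let $\mathbb{H}$ be a complex Hilbert space. If $T\in\mathbb{B}(\mathbb{H})$ is an accretive-dissipative operator, then $\|(\Re T,\Im T)\|_e=\omega(T)$.
   Context: $\mathbb{B}(\mathbb{H})$ is the algebra of bounded linear operators on $\mathbb{H}$. $\Re T=\frac{T+T^*}{2}$ and $\Im T=\frac{T-T^*}{2\mathrm{i}}$ are the real and imaginary parts of $T$; $T$ is accretive-dissipative if both $\Re T$ and $\Im T$ are positive (semidefinite) operators. $\omega(T)=\sup_{\|x\|=1}|\langle Tx,x\rangle|$ is the numerical radius. The Euclidean operator norm of a pair is $\|(A,B)\|_e=\sup\{\|\lambda_1A+\lambda_2B\|:\lambda_1,\lambda_2\in\mathbb{C},\ |\lambda_1|^2+|\lambda_2|^2\le 1\}$, where $\|\cdot\|$ is the operator norm; equivalently (known), $\|(A,B)\|_e=\sup_{\|x\|=\|y\|=1}\left(|\langle Ax,y\rangle|^2+|\langle Bx,y\rangle|^2\right)^{1/2}$. *)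

(* Defs.v *)
From HB Require Import structures.
From mathcomp Require Import all_boot all_order all_algebra.
From mathcomp Require Import complex.
From mathcomp Require Import all_classical all_reals all_analysis.

Set Implicit Arguments.
Unset Strict Implicit.
Unset Printing Implicit Defensive.

Import Order.TTheory GRing.Theory Num.Theory.
Import numFieldNormedType.Exports.

Local Open Scope classical_set_scope.
Local Open Scope ring_scope.
Local Open Scope complex_scope.

(* A complex Hilbert space over R[i] = R + iR: a complete normed module whose
   norm comes from an inner product. {dot V for Num.conj} is the library's type
   of positive definite hermitian forms; they are linear in the first argument
   and conjugate-linear in the second. *)
HB.mixin Record CompleteNormedModule_isHilbert (R : realType) V
    & CompleteNormedModule R[i] V := {
  inner : {dot V for @Num.conj R[i]} ;
  inner_norm : forall x : V, inner x x = `|x| ^+ 2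
}.

#[short(type="hilbertType")]
HB.structure Definition Hilbert (R : realType) :=
  {V of CompleteNormedModule_isHilbert R V & CompleteNormedModule R[i] V}.

Section operators.
Context {R : realType} {H : hilbertType R}.
Implicit Types (A B T : H -> H) (x y z : H).

Local Notation "''[' x , y ]" := (@inner R H x y) (format "''[' x ,  y ]").

(* [adjoint T y] is the vector z with '[T x, y] = '[x, z] for all x. It is
   unique by definiteness and exists by Riesz's theorem when T is linear and
   bounded; where there is none, [adjoint T y] is 0. *)
Definition adjoint T : H -> H :=
  fun y => xget 0 [set z | forall x, '[T x, y] = '[x, z]].

Definition re_op T : H -> H := fun x => 2^-1 *: (T x + adjoint T x).

Definition im_op T : H -> H := fun x => (2 * 'i%C)^-1 *: (T x - adjoint T x).

(* For z in R[i], 0 <= z says that z is real and nonnegative; over the complex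
   numbers this makes A self-adjoint. *)
Definition positive_op A := forall x, 0 <= '[A x, x].

Definition accretive_dissipative T := positive_op (re_op T) /\ positive_op (im_op T).

(* Norms and moduli take values in R[i], hence the real parts: suprema are
   taken in R. [sup] is 0 on the empty set, which is why numerical_radius is 0
   on the zero space. *)
Definition op_norm A : R :=
  sup [set complex.Re `|A x| | x in [set x : H | `|x| <= 1]].

Definition numerical_radius A : R :=
  sup [set complex.Re `|'[A x, x]| | x in [set x : H | `|x| = 1]].

Definition euclidean_norm A B : R :=
  sup [set op_norm (fun x => l.1 *: A x + l.2 *: B x)
      | l in [set l : R[i] * R[i] | `|l.1| ^+ 2 + `|l.2| ^+ 2 <= 1]].

End operators.

(* Main.v *)
Require Import Defs.
From mathcomp Require Import all_boot all_order all_algebra.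
From mathcomp Require Import complex ring.
From mathcomp Require Import all_classical all_reals all_analysis.

Set Implicit Arguments.
Unset Strict Implicit.
Unset Printing Implicit Defensive.

Import Order.TTheory GRing.Theory Num.Theory.
Import numFieldNormedType.Exports.

Local Open Scope classical_set_scope.
Local Open Scope ring_scope.

(** Put A = re_op T and B = im_op T, so that T = A + iB, and let w be the
    numerical radius of T.

    Since A and B are positive, <Ax,x> and <Bx,x> are nonnegative reals, and
    |<Tx,x>|^2 = <Ax,x>^2 + <Bx,x>^2 (sqr_norm_form).

    The Euclidean norm is at most w. Let |l1|^2 + |l2|^2 <= 1 and
    S = l1 A + l2 B. The Cauchy-Schwarz inequality in C^2, then the one for the
    semidefinite forms of A and B, then the one in R^2 give (comb_form_le)
      |<Sx,y>|^2 <= |<Ax,y>|^2 + |<Bx,y>|^2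
                 <= <Ax,x><Ay,y> + <Bx,x><By,y> <= |<Tx,x>| |<Ty,y>|,
    which is at most w^2 |x|^2 |y|^2. Taking y = Sx yields |Sx| <= w |x|.

    The Euclidean norm is at least w. For a unit vector x the choice
    (l1, l2) = (<Ax,x>, <Bx,x>) / |<Tx,x>| gives <Sx,x> = |<Tx,x>|, hence
    |<Tx,x>| <= |Sx| (comb_norm_ge).

    All this needs A and B to be the genuine real and imaginary parts, that is,
    adjoint T to be an adjoint of T. Riesz's theorem would give it; adjointP
    gets it from accretive-dissipativity by algebra alone. *)

(** * Cauchy-Schwarz inequalities *)

(** Evaluating the form at a suitable combination of x and y makes the
    inequality appear multiplied by f y y or by f x x. As the form may be
    degenerate, the case where both vanish has to be treated apart; positivity
    then forces f x y = 0. *)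
Lemma semidefinite_CauchySchwarz (C : numClosedFieldType) (U : lmodType C)
    (f : U -> U -> C) (f_linear : forall y, scalar (f^~ y))
    (f_hermitian : forall x y, f x y = (f y x)^*)
    (f_ge0 : forall x, 0 <= f x x) (x y : U) :
  `|f x y| ^+ 2 <= f x x * f y y.
Proof.
have expand a b : f (a *: x + b *: y) (a *: x + b *: y) =
    a * a^* * f x x + (a * b^* * f x y + b * a^* * (f x y)^* + b * b^* * f y y).
  have fZ c u v : f (c *: u) v = c * f u v.
    have f0 : f 0 v = 0.
      by have := f_linear v (-1) 0 0; rewrite scaler0 addr0 mulN1r addNr.
    by have := f_linear v c u 0; rewrite /= !addr0 f0 addr0.
  have step u : f u (a *: x + b *: y) = a^* * f u x + b^* * f u y.
    rewrite f_hermitian f_linear fZ rmorphD !rmorphM /=.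
    by rewrite -!f_hermitian.
  rewrite f_linear fZ !step (f_hermitian y x); ring.
have [fx0 fy0] := (f_ge0 x, f_ge0 y).
have fxR : (f x x)^* = f x x by rewrite -f_hermitian.
have fyR : (f y y)^* = f y y by rewrite -f_hermitian.
rewrite normCK.
have [fy_eq0|fy_neq0] := eqVneq (f y y) 0; last first.
  have := f_ge0 (f y y *: x + (- f x y) *: y).
  rewrite expand rmorphN /= fyR -[_ <= f x x * _]subr_ge0.
  rewrite (_ : _ + _ = f y y * (f x x * f y y - f x y * (f x y)^*)); last ring.
  by rewrite pmulr_rge0 // lt0r fy_neq0.
have [fx_eq0|fx_neq0] := eqVneq (f x x) 0; last first.
  have := f_ge0 ((f x y)^* *: x + (- f x x) *: y).
  rewrite expand rmorphN /= conjCK fxR -[_ <= f x x * _]subr_ge0.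
  rewrite (_ : _ + _ = f x x * (f x x * f y y - f x y * (f x y)^*)); last ring.
  by rewrite pmulr_rge0 // lt0r fx_neq0.
(* Here the quadratic form takes the value -2 |f x y|^2. *)
have := f_ge0 ((f x y)^* *: x + (- 1) *: y).
rewrite expand rmorphN rmorph1 /= conjCK fx_eq0 fy_eq0 !mulr0 !add0r addr0.
rewrite (_ : _ + _ = - ((f x y * (f x y)^*) *+ 2)); last ring.
by rewrite oppr_ge0 pmulrn_lle0.
Qed.

(** Lagrange's identity: the difference of the two sides is
    |a q^* - b p^*|^2. *)
Lemma CauchySchwarz2 (C : numClosedFieldType) (a b p q : C) :
  `|a * p + b * q| ^+ 2 <= (`|a| ^+ 2 + `|b| ^+ 2) * (`|p| ^+ 2 + `|q| ^+ 2).
Proof.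
rewrite -subr_ge0 (_ : _ - _ = `|a * q^* - b * p^*| ^+ 2) ?exprn_ge0 //.
by rewrite !normCK rmorphB rmorphD !rmorphM /= !conjCK; ring.
Qed.

(** * The inner product *)

Section operators.
Context {R : realType} {H : hilbertType R}.
Implicit Types (T : {linear H -> H}) (x y z : H) (l : R[i] * R[i]).

Local Notation "''[' x , y ]" := (@inner R H x y) (format "''[' x ,  y ]").
Local Notation i := ('i%C : R[i]).

Lemma conj_i : i^* = - i.
Proof. by apply/eqP; rewrite eq_complex /= oppr0 !eqxx. Qed.

Lemma mul_ii : i * i = -1.
Proof. by rewrite -expr2 sqr_i. Qed.

Lemma i_neq0 : i != 0.
Proof. by rewrite eq_complex /= oner_eq0 andbF. Qed.

Lemma conj_inv2i : ((2 * i)^-1)^* = - (2 * i)^-1.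
Proof.
have -> : ((2 * i)^-1)^* = (2^* * i^*)^-1 by rewrite fmorphV rmorphM.
by rewrite rmorph_nat conj_i mulrN invrN.
Qed.

Lemma inner_linear y : scalar (fun x => '[x, y]).
Proof. by move=> a u v; rewrite linearPl. Qed.

Lemma innerC x y : '[x, y] = '[y, x]^*.
Proof. by rewrite hermC expr0 mul1r. Qed.

Lemma inner_CauchySchwarz x y : `|'[x, y]| <= `|x| * `|y|.
Proof.
rewrite -(@ler_pXn2r _ 2) ?nnegrE ?mulr_ge0 // exprMn -!inner_norm.
apply: (semidefinite_CauchySchwarz (f := fun x y => '[x, y])).
- exact: inner_linear.
- exact: innerC.
- by move=> u; rewrite inner_norm exprn_ge0.
Qed.

Lemma innerDl x y z : '[x + y, z] = '[x, z] + '[y, z].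
Proof. exact: linearDl. Qed.

Lemma innerDr x y z : '[z, x + y] = '[z, x] + '[z, y].
Proof. exact: linearDr. Qed.

Lemma innerBl x y z : '[x - y, z] = '[x, z] - '[y, z].
Proof. exact: linearBl. Qed.

Lemma innerBr x y z : '[z, x - y] = '[z, x] - '[z, y].
Proof. exact: linearBr. Qed.

Lemma innerZl (c : R[i]) x y : '[c *: x, y] = c * '[x, y].
Proof. exact: linearZl_LR. Qed.

Lemma innerZr (c : R[i]) x y : '[x, c *: y] = c^* * '[x, y].
Proof. exact: linearZr_LR. Qed.

(** * Existence of the adjoint *)

(** Polarization: vanishing at x + y and at x + iy makes <Tx,y> and <Ty,x> both
    opposite and equal. The complex scalars matter, a rotation of the real plane
    being a counterexample over the reals. *)
Lemma quadratic_form_eq0 T :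
  (forall x, '[T x, x] = 0) -> forall x y, '[T x, y] = 0.
Proof.
move=> T0 x y.
have sum0 : '[T x, y] + '[T y, x] = 0.
  have := T0 (x + y).
  by rewrite (linearD T) innerDl !innerDr !T0 add0r addr0.
have diff0 : '[T x, y] - '[T y, x] = 0.
  have := T0 (x + i *: y).
  rewrite (linearD T) (linearZ_LR T) innerDl !innerDr !innerZl !innerZr /= !T0.
  rewrite !mulr0 add0r addr0 conj_i mulNr addrC -mulrBr => /eqP.
  rewrite mulf_eq0 (negPf i_neq0) /= => /eqP xy.
  by rewrite -[LHS]opprK opprB xy oppr0.
have /eqP : '[T x, y] *+ 2 = 0.
  by rewrite -[RHS](addr0 0) -{1}sum0 -diff0; ring.
by rewrite mulrn_eq0 => /eqP.
Qed.

Lemma re_im_opE T x : re_op T x + i *: im_op T x = T x.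
Proof.
rewrite /re_op /im_op scalerA invfM mulrCA divff ?i_neq0 // mulr1.
rewrite -scalerDr addrACA subrr addr0 -mulr2n -[T x *+ 2]scaler_nat scalerA.
by rewrite mulVf ?scale1r.
Qed.

(** Let D be the subspace of the y for which x |-> <Tx,y> is represented by a
    vector; adjoint T is 0 outside D. For w outside D, both <Tw,w>/2 and
    <Tw,w>/(2i) are therefore nonnegative, so <Tw,w> = 0. If some y is outside
    D, then so are y + z and y - z for every z in D, and the parallelogram
    identity for the quadratic form <Tz,z> makes it vanish on D as well. Then
    T = 0 by polarization, and D is the whole space after all. *)
Lemma adjointP T : accretive_dissipative T ->
  forall x y, '[T x, y] = '[x, adjoint T y].
Proof.
move=> [re_ge0 im_ge0].
pose D y := exists z, forall x, '[T x, y] = '[x, z].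
suff D_full y : D y by move=> x y; move: x; apply: xgetPex (D_full y).
have outside w : ~ D w -> '[T w, w] = 0.
  move=> Dw; have adj0 : adjoint T w = 0.
    by apply: xgetPN => z Tz; apply: Dw; exists z.
  have := re_ge0 w; have := im_ge0 w.
  rewrite /re_op /im_op adj0 subr0 addr0 !innerZl /=.
  set q := '[T w, w] => im_w re_w.
  have q_ge0 : 0 <= q by move: re_w; rewrite pmulr_rge0 // invr_gt0 ltr0n.
  have qR : q^* = q := geC0_conj q_ge0.
  have := geC0_conj im_w; rewrite rmorphM /= conj_inv2i qR mulNr => /eqP.
  rewrite eq_sym -addr_eq0 -mulr2n mulrn_eq0 /=.
  by rewrite mulf_eq0 invr_eq0 mulf_eq0 pnatr_eq0 (negPf (i_neq0)) => /eqP.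
apply: contrapT => Dy.
have q0 z : '[T z, z] = 0.
  have [Dz|] := pselect (D z); last exact: outside.
  have DB u : D (y + u) -> D u -> False.
    move=> [a Ta] [b Tb]; apply: Dy; exists (a - b) => x.
    by rewrite innerBr /= -Ta -Tb -innerBr /= addrK.
  have [/= qp qm qy] : [/\ '[T (y + z), y + z] = 0, '[T (y - z), y - z] = 0
      & '[T y, y] = 0].
    split; apply: outside => // Dyz; first exact: DB Dyz Dz.
    apply: DB Dyz _; have [b Tb] := Dz; exists (- b) => x.
    by rewrite -[- z]scaleN1r -[- b]scaleN1r !innerZr Tb.
  move: qp qm; rewrite (linearB T) (linearD T) !innerBl !innerBr.
  rewrite !innerDl !innerDr /= qy => qp qm.
  have := congr2 +%R qp qm; rewrite addr0.
  rewrite (_ : _ + _ = '[T z, z] *+ 2); last by ring.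
  by move=> /eqP; rewrite mulrn_eq0 => /eqP.
by apply: Dy; exists 0 => x; rewrite linear0r; apply: quadratic_form_eq0.
Qed.

(** * The real and imaginary parts *)

Section accretive_dissipative.
Variable T : {linear H -> H}.
Hypothesis T_ad : accretive_dissipative T.

Lemma inner_adjoint x y : '[adjoint T x, y] = '[x, T y].
Proof. by rewrite innerC -adjointP // -innerC. Qed.

Lemma re_op_CauchySchwarz x y :
  `|'[re_op T x, y]| ^+ 2 <= '[re_op T x, x] * '[re_op T y, y].
Proof.
have reE u v : '[re_op T u, v] = 2^-1 * ('[T u, v] + '[u, T v]).
  by rewrite innerZl innerDl inner_adjoint.
apply: (semidefinite_CauchySchwarz (f := fun x y => '[re_op T x, y])).
- by move=> v c u w; rewrite /= !reE (linearP T) !innerDl !innerZl /=; ring.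
- move=> u v; rewrite !reE rmorphM rmorphD /= fmorphV rmorph_nat -!innerC.
  by rewrite addrC.
- by move=> u; case: T_ad => + _; apply.
Qed.

Lemma im_op_CauchySchwarz x y :
  `|'[im_op T x, y]| ^+ 2 <= '[im_op T x, x] * '[im_op T y, y].
Proof.
have imE u v : '[im_op T u, v] = (2 * i)^-1 * ('[T u, v] - '[u, T v]).
  by rewrite innerZl innerBl inner_adjoint.
apply: (semidefinite_CauchySchwarz (f := fun x y => '[im_op T x, y])).
- by move=> v c u w; rewrite /= !imE (linearP T) !innerDl !innerZl /=; ring.
- move=> u v; rewrite !imE rmorphM rmorphB /= conj_inv2i -!innerC.
  by rewrite mulNr -mulrN opprB.
- by move=> u; case: T_ad => _; apply.
Qed.

Lemma sqr_norm_form x :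
  `|'[T x, x]| ^+ 2 = '[re_op T x, x] ^+ 2 + '[im_op T x, x] ^+ 2.
Proof.
have [/(_ x) re_ge0 /(_ x) im_ge0] := T_ad.
rewrite normCK -{1 2}re_im_opE innerDl innerZl /= rmorphD rmorphM /= conj_i.
rewrite !geC0_conj //; set a := '[_, _]; set b := '[_, _].
rewrite (_ : _ * _ = a ^+ 2 - i * i * b ^+ 2); last ring.
by rewrite mul_ii mulN1r opprK.
Qed.

Definition comb l x := l.1 *: re_op T x + l.2 *: im_op T x.

(** The key estimate: the three Cauchy-Schwarz inequalities in a row. *)
Lemma comb_form_le l x y : `|l.1| ^+ 2 + `|l.2| ^+ 2 <= 1 ->
  `|'[comb l x, y]| ^+ 2 <= `|'[T x, x]| * `|'[T y, y]|.
Proof.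
have [re_ge0 im_ge0] := T_ad.
move=> l1; rewrite innerDl (innerZl l.1) (innerZl l.2) /=.
apply: le_trans (CauchySchwarz2 _ _ _ _) _.
apply: le_trans (ler_piMl _ l1) _; first by rewrite addr_ge0 ?exprn_ge0.
apply: le_trans (lerD (re_op_CauchySchwarz x y) (im_op_CauchySchwarz x y)) _.
rewrite -(@ler_pXn2r _ 2) ?nnegrE ?addr_ge0 ?mulr_ge0 // exprMn !sqr_norm_form.
have := CauchySchwarz2 '[re_op T x, x] '[im_op T x, x]
  '[re_op T y, y] '[im_op T y, y].
by rewrite !ger0_norm ?addr_ge0 ?mulr_ge0.
Qed.

(** The estimate of comb_form_le at y = comb l x, where <comb l x, y> = |y|^2,
    so that a factor |y| cancels. *)
Lemma comb_norm_le (w : R[i]) : (forall x, `|'[T x, x]| <= w * `|x| ^+ 2) ->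
  0 <= w -> forall l x, `|l.1| ^+ 2 + `|l.2| ^+ 2 <= 1 ->
  `|comb l x| <= w * `|x|.
Proof.
move=> Tw w0 l x l1; set y := comb l x.
have [->|y0] := eqVneq y 0; first by rewrite normr0 mulr_ge0.
have := comb_form_le x y l1; rewrite -/y inner_norm ger0_norm ?exprn_ge0 //.
move=> /le_trans /(_ (ler_pM (normr_ge0 _) (normr_ge0 _) (Tw x) (Tw y))).
rewrite mulrACA -!expr2 -!exprMn ler_pXn2r ?nnegrE ?mulr_ge0 ?exprn_ge0 //.
by rewrite mulrA expr2 ler_pM2r ?normr_gt0.
Qed.

(** The maximizing pair l has the direction of (<Ax,x>, <Bx,x>), for A = re_op T
    and B = im_op T. *)
Lemma comb_norm_ge x : `|x| = 1 -> exists2 l,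
  `|l.1| ^+ 2 + `|l.2| ^+ 2 <= 1 & `|'[T x, x]| <= `|comb l x|.
Proof.
move=> x1; have [/(_ x) re_ge0 /(_ x) im_ge0] := T_ad.
(* If n = 0, dividing by n gives l = (0, 0), which is a valid choice. *)
pose n := `|'[T x, x]|; have n_ge0 : 0 <= n := normr_ge0 _.
exists ('[re_op T x, x] / n, '[im_op T x, x] / n) => /=.
  rewrite !normrM !ger0_norm ?invr_ge0 // !exprMn -mulrDl.
  rewrite -sqr_norm_form -/n -exprMn.
  have [->|n0] := eqVneq n 0; first by rewrite mul0r expr0n ler01.
  by rewrite divff // expr1n.
set l := (_, _); have := inner_CauchySchwarz (comb l x) x.
rewrite x1 mulr1; apply: le_trans.
rewrite innerDl (innerZl l.1) [X in _ + X]innerZl /=.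
rewrite mulrAC [X in _ + X]mulrAC -mulrDl -!expr2 -sqr_norm_form -/n.
by have [->|n0] := eqVneq n 0; rewrite ?mulr0 // expr2 mulfK // ger0_norm.
Qed.

End accretive_dissipative.

(** * Suprema *)

Lemma le_Re (z w : R[i]) : z <= w -> complex.Re z <= complex.Re w.
Proof. by rewrite lecE => /andP[]. Qed.

Lemma ge0_ReK (z : R[i]) : 0 <= z -> (complex.Re z)%:C%C = z.
Proof. by case: z => a b; rewrite lecE /= => /andP[/eqP-> _]. Qed.

(** The empty and the unbounded sets are included, their supremum being 0. *)
Lemma sup_ge0 (A : set R) : (forall a, A a -> 0 <= a) -> 0 <= sup A.
Proof.
move=> A_ge0; have [[[a Aa] Aub]|/sup_out-> //] := pselect (has_sup A).
by apply: le_trans (A_ge0 a Aa) _; exact: ub_le_sup.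
Qed.

Lemma numerical_radius_has_ubound T : bounded_near T (nbhs (0 : H)) ->
  has_ubound [set complex.Re `|'[T x, x]| | x in [set x : H | `|x| = 1]].
Proof.
move=> /bounded_funP /(_ 1) [M TM]; exists (complex.Re M) => _ [x x1 <-].
apply: le_Re; apply: le_trans (inner_CauchySchwarz _ _) _.
by rewrite x1 mulr1 TM // x1.
Qed.

Lemma numerical_radius_ge0 T : 0 <= numerical_radius T.
Proof.
rewrite /numerical_radius; apply: sup_ge0 => _ [x _ <-].
exact: (@le_Re 0).
Qed.

Lemma form_le_numerical_radius T x : bounded_near T (nbhs (0 : H)) ->
  `|'[T x, x]| <= (numerical_radius T)%:C%C * `|x| ^+ 2.
Proof.
move=> Tb; have [->|x0] := eqVneq x 0.
  by rewrite linear0r normr0 normr0 expr0n mulr0.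
have nx0 : `|x| != 0 by rewrite normr_eq0.
have u1 : `|(`|x|^-1 *: x)| = 1 by rewrite normrZ normfV normr_id mulVf.
have := ub_le_sup (numerical_radius_has_ubound Tb) (ex_intro2 _ _ _ u1 erefl).
rewrite -lecR ge0_ReK // (linearZ_LR T) innerZl innerZr !normrM norm_conjC.
rewrite normfV normr_id mulrA -expr2 exprVn mulrC ler_pdivrMr //.
by rewrite exprn_gt0 // normr_gt0.
Qed.

End operators.

Theorem corollary2p9 (R : realType) (H : hilbertType R) (T : {linear H -> H})
    (T_bounded : bounded_near T (nbhs (0 : H)))
    (T_accretive_dissipative : accretive_dissipative T) :
  euclidean_norm (re_op T) (im_op T) = numerical_radius T.
Proof.
set w := numerical_radius T.
have w_ge0 : 0 <= w := numerical_radius_ge0 T.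
have comb_le l x : `|l.1| ^+ 2 + `|l.2| ^+ 2 <= 1 -> `|x| <= 1 ->
    complex.Re `|comb T l x| <= w.
  move=> l1 x1; rewrite -lecR ge0_ReK //.
  apply: le_trans (ler_piMr _ x1); last by rewrite lecR.
  apply: comb_norm_le => // [y|]; last by rewrite lecR.
  exact: form_le_numerical_radius.
pose values l := [set complex.Re `|comb T l x| | x in [set x : H | `|x| <= 1]].
have values_ub l : `|l.1| ^+ 2 + `|l.2| ^+ 2 <= 1 -> ubound (values l) w.
  by move=> l1 _ [x x1 <-]; exact: comb_le.
have norm_le l : `|l.1| ^+ 2 + `|l.2| ^+ 2 <= 1 -> op_norm (comb T l) <= w.
  move=> l1; apply: ge_sup (values_ub l l1).
  by exists (complex.Re `|comb T l 0|), 0; rewrite //= normr0.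
have euclid_ub : has_ubound [set op_norm (comb T l)
    | l in [set l : R[i] * R[i] | `|l.1| ^+ 2 + `|l.2| ^+ 2 <= 1]].
  by exists w => _ [l l1 <-]; exact: norm_le.
have euclid_ge l x : `|l.1| ^+ 2 + `|l.2| ^+ 2 <= 1 -> `|x| <= 1 ->
    complex.Re `|comb T l x| <= euclidean_norm (re_op T) (im_op T).
  move=> l1 x1.
  apply: le_trans (ub_le_sup euclid_ub (ex_intro2 _ _ l l1 erefl)).
  by apply: ub_le_sup; [exists w; exact: values_ub | exists x].
have l0 : `|(0 : R[i])| ^+ 2 + `|(0 : R[i])| ^+ 2 <= 1.
  by rewrite normr0 expr0n addr0 ler01.
apply/eqP; rewrite eq_le; apply/andP; split.
  apply: ge_sup; last by move=> _ [l l1 <-]; exact: norm_le.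
  by exists (op_norm (comb T (0, 0))), (0, 0).
(* Without unit vectors the space is zero, and so is the numerical radius. *)
have [unit|no_unit] := pselect ([set x : H | `|x| = 1] !=set0).
  apply: ge_sup.
    by case: unit => x x1; exists (complex.Re `|inner (T x) x|), x.
  move=> _ [x x1 <-].
  have [l l1 /le_Re le_l] := comb_norm_ge T_accretive_dissipative x1.
  by apply: le_trans le_l _; apply: euclid_ge => //; rewrite x1.
rewrite /w /numerical_radius (_ : [set x : H | _] = set0) ?image_set0 ?sup0.
  apply: le_trans (euclid_ge (0, 0) 0 l0 _); last by rewrite normr0 ler01.
  exact: (@le_Re _ 0).
by apply/eqP; apply: contrapT => /negP /set0P.
Qed.
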